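(* Let $\mathrm{T}\in\Lambda^3(\mathbb{R}^n)$ be any $3$-form on euclidean space. Then the Lie algebra $\mathfrak{g}_{\mathrm{T}}^*$ is semisimple and coincides with the infinitesimal holonomy algebra $\mathfrak{h}_{\mathrm{T}}^*$, i.e. $\mathfrak{h}_{\mathrm{T}}^*=[\mathfrak{g}_{\mathrm{T}}^*,\mathfrak{g}_{\mathrm{T}}^*]=\mathfrak{g}_{\mathrm{T}}^*$.
   Context: $\mathbb{R}^n$ carries its standard inner product. $\mathrm{Cl}(\mathbb{R}^n)$ is the Clifford algebra with convention $X\cdot X=-\|X\|^2$; as a vector space it is identified with the exterior algebra $\Lambda^*(\mathbb{R}^n)$ (via $e_{i_1}\wedge\dots\wedge e_{i_k}\mapsto e_{i_1}\cdots e_{i_k}$ for an orthonormal basis). $\mathfrak{cl}(\mathbb{R}^n)$ is the Lie algebra $\mathrm{Cl}(\mathbb{R}^n)$ with bracket $[\alpha,\beta]=\alpha\cdot\beta-\beta\cdot\alpha$. The $2$-forms constitute the Lie subalgebra $\mathfrak{so}(n)\subset\mathfrak{cl}(\mathbb{R}^n)$. For an exterior form $\mathrm{T}$ and a vector $X$, $X\lrcorner\,\mathrm{T}$ denotes the interior product. $\mathfrak{g}_{\mathrm{T}}^*$ is the Lie subalgebra of $\mathfrak{cl}(\mathbb{R}^n)$ generated by all elements $X\lrcorner\,\mathrm{T}$, $X\in\mathbb{R}^n$ (for a $3$-form it is a subalgebra of $\mathfrak{so}(n)$), and $\mathfrak{h}_{\mathrm{T}}^*:=[\mathfrak{g}_{\mathrm{T}}^*,\mathfrak{g}_{\mathrm{T}}^*]$.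 The zero Lie algebra (occurring for $\mathrm{T}=0$) counts as semisimple. *)

(* Defs.v *)
From HB Require Import structures.
From mathcomp Require Import all_boot all_order all_algebra.
From mathcomp Require Import all_classical all_reals.
From mathcomp Require Import ring.

Set Implicit Arguments.
Unset Strict Implicit.
Unset Printing Implicit Defensive.

Import Order.TTheory GRing.Theory Num.Theory.
Local Open Scope ring_scope.

(* For i_1 < ... < i_k the coordinate at S = {i_1, ..., i_k} is the coefficient
   of e_{i_1} ^ ... ^ e_{i_k}, read in the Clifford algebra as the product
   e_{i_1} ... e_{i_k} (see cl_basisE); so this type is both the exterior
   algebra and the Clifford algebra of R^n. *)
Definition clifford (R : comNzRingType) (n : nat) : Type :=
  {ffun {set 'I_n} -> R}.

HB.instance Definition _ (R : comNzRingType) n :=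
  GRing.Lmodule.copy (clifford R n) {ffun {set 'I_n} -> R^o}.
HB.instance Definition _ (R : comNzRingType) n :=
  Vector.copy (clifford R n) {ffun {set 'I_n} -> R^o}.

Section CliffordProduct.
Context {R : comNzRingType} {n : nat}.
Implicit Types (S U W : {set 'I_n}) (a b c : clifford R n) (X Y : 'rV[R]_n).

Definition symdiff S U : {set 'I_n} := [set i | (i \in S) (+) (i \in U)].

(* The pairs with j < i count the transpositions that sort e_S e_U; the pairs
   with i = j account for e_i e_i = -1. *)
Definition cl_sign S U : R :=
  (-1) ^+ #|[set p : 'I_n * 'I_n | [&& p.1 \in S, p.2 \in U & p.2 <= p.1]%N]|.

Definition cl_mul a b : clifford R n :=
  [ffun W : {set 'I_n} => \sum_S \sum_(U | symdiff S U == W) cl_sign S U * (a S * b U)].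

Definition cl_basis S : clifford R n := [ffun U : {set 'I_n} => (U == S)%:R].

Definition cl_one : clifford R n := cl_basis finset.set0.

Definition cl_vec X : clifford R n := \sum_i X 0 i *: cl_basis (finset.set1 i).

Definition is_form (k : nat) a : Prop :=
  forall S : {set 'I_n}, #|S| != k -> a S = 0.

(* e_i _| (e_i ^ e_S) = e_S for i \notin S, and sorting e_i ^ e_S moves e_i past
   the elements of S smaller than i. *)
Definition contract X a : clifford R n :=
  [ffun S : {set 'I_n} => \sum_(i | i \notin S)
     (-1) ^+ #|[set j in S | (j < i)%N]| * X 0 i * a (i |: S)%SET].

Lemma symdiffC : commutative symdiff.
Proof. by move=> S U; apply/setP => i; rewrite !inE addbC. Qed.

Lemma symdiffA : associative symdiff.
Proof. by move=> S U W; apply/setP => i; rewrite !inE addbA. Qed.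

Lemma symdiffK S : involutive (symdiff S).
Proof. by move=> U; apply/setP => i; rewrite !inE addKb. Qed.

Lemma symdiff_eq S U W : (symdiff S U == W) = (U == symdiff S W).
Proof. by apply/eqP/eqP => [<-|->]; rewrite symdiffK. Qed.

Lemma symdiff0 S : symdiff finset.set0 S = S.
Proof. by apply/setP => i; rewrite !inE. Qed.

Lemma symdiffv S : symdiff S S = finset.set0.
Proof. by apply/setP => i; rewrite !inE addbb. Qed.

Lemma symdiffn0 S : symdiff S finset.set0 = S.
Proof. by rewrite symdiffC symdiff0. Qed.

Lemma symdiff1 i S : i \notin S -> symdiff (finset.set1 i) S = (i |: S)%SET.
Proof.
move=> iS; apply/setP => j; rewrite !inE.
by case: (eqVneq j i) => [->|//] /=; rewrite (negPf iS).
Qed.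

Lemma symdiffD1 i S : i \in S -> symdiff (finset.set1 i) S = (S :\ i)%SET.
Proof.
move=> iS; apply/setP => j; rewrite !inE.
by case: (eqVneq j i) => [->|//] /=; rewrite iS.
Qed.

Lemma cl_signE S U : cl_sign S U =
  \prod_i \prod_j (-1) ^+ [&& i \in S, j \in U & j <= i]%N.
Proof.
rewrite pair_big /= /cl_sign -prodr_const big_mkcond /=.
by apply: eq_bigr => p _; rewrite inE; case: ifP.
Qed.

Lemma cl_signDl S U W : cl_sign (symdiff S U) W = cl_sign S W * cl_sign U W.
Proof.
rewrite !cl_signE -big_split; apply: eq_bigr => i _.
rewrite -big_split; apply: eq_bigr => j _ /=; rewrite inE -signr_addb.
by case: (i \in S); case: (i \in U); rewrite /= ?addbb ?addbF ?andbF.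
Qed.

Lemma cl_signDr S U W : cl_sign S (symdiff U W) = cl_sign S U * cl_sign S W.
Proof.
rewrite !cl_signE -big_split; apply: eq_bigr => i _.
rewrite -big_split; apply: eq_bigr => j _ /=; rewrite inE -signr_addb.
by case: (i \in S); case: (j \in U); case: (j \in W); case: (_ <= _)%N.
Qed.

Lemma cl_sign0l S : cl_sign finset.set0 S = 1.
Proof. by rewrite cl_signE big1 // => i _; rewrite big1 // => j _; rewrite inE. Qed.

Lemma cl_sign0r S : cl_sign S finset.set0 = 1.
Proof.
by rewrite cl_signE big1 // => i _; rewrite big1 // => j _; rewrite inE andbF.
Qed.

Lemma cl_mulE a b W :
  cl_mul a b W = \sum_S cl_sign S (symdiff S W) * (a S * b (symdiff S W)).
Proof.
rewrite ffunE; apply: eq_bigr => S _.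
by rewrite (eq_bigl _ _ (fun U => symdiff_eq S U W)) big_pred1_eq.
Qed.

Lemma cl_mulDl : left_distributive cl_mul +%R.
Proof.
move=> a b c; apply/ffunP => W; rewrite [RHS]ffunE !cl_mulE -big_split.
by apply: eq_bigr => S _; rewrite ffunE mulrDl mulrDr.
Qed.

Lemma cl_mulDr : right_distributive cl_mul +%R.
Proof.
move=> a b c; apply/ffunP => W; rewrite [RHS]ffunE !cl_mulE -big_split.
by apply: eq_bigr => S _; rewrite ffunE !mulrDr.
Qed.

Lemma cl_mul1l : left_id cl_one cl_mul.
Proof.
move=> a; apply/ffunP => W; rewrite cl_mulE (bigD1 finset.set0) //= big1.
  by rewrite symdiff0 cl_sign0l ffunE eqxx !mul1r addr0.
by move=> S /negPf nS; rewrite ffunE nS mul0r mulr0.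
Qed.

Lemma cl_mul1r : right_id cl_one cl_mul.
Proof.
move=> a; apply/ffunP => W; rewrite cl_mulE (bigD1 W) //= big1.
  by rewrite symdiffv cl_sign0r ffunE eqxx mul1r mulr1 addr0.
move=> S nS; rewrite [cl_one _]ffunE symdiff_eq symdiffn0.
by rewrite eq_sym (negPf nS) !mulr0.
Qed.

Lemma cl_mulA : associative cl_mul.
Proof.
move=> a b c; apply/ffunP => W; rewrite [LHS]cl_mulE [RHS]cl_mulE.
pose G S P := cl_sign S (symdiff S P) * (a S * b (symdiff S P)) *
              (cl_sign P (symdiff P W) * c (symdiff P W)).
transitivity (\sum_S \sum_P G S P); last first.
  rewrite exchange_big; apply: eq_bigr => P _ /=.
  rewrite cl_mulE mulrCA [RHS]mulr_suml; apply: eq_bigr => S _.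
  by rewrite /G.
apply: eq_bigr => S _; rewrite (reindex_inj (inv_inj (symdiffK S))) /=.
rewrite cl_mulE !mulr_sumr; apply: eq_bigr => Q _; rewrite /G symdiffK.
have -> : symdiff Q (symdiff S W) = symdiff (symdiff S Q) W.
  by rewrite symdiffA (symdiffC Q).
set V := symdiff (symdiff S Q) W.
have -> : symdiff S W = symdiff Q V.
  by rewrite /V (symdiffC S Q) -symdiffA symdiffK.
by rewrite cl_signDr cl_signDl; ring.
Qed.

Lemma cl_one_neq0 : cl_one != 0.
Proof.
apply/eqP => /ffunP/(_ finset.set0); rewrite ffunE eqxx [RHS]ffunE => /eqP.
by rewrite oner_eq0.
Qed.

Lemma cl_scaleE (k : R) a S : (k *: a) S = k * a S.
Proof. by rewrite ffunE. Qed.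

Lemma cl_scaleAl (k : R) a b : k *: cl_mul a b = cl_mul (k *: a) b.
Proof.
apply/ffunP => W; rewrite cl_scaleE !cl_mulE mulr_sumr.
by apply: eq_bigr => S _; rewrite cl_scaleE; ring.
Qed.

Lemma cl_scaleAr (k : R) a b : k *: cl_mul a b = cl_mul a (k *: b).
Proof.
apply/ffunP => W; rewrite cl_scaleE !cl_mulE mulr_sumr.
by apply: eq_bigr => S _; rewrite cl_scaleE; ring.
Qed.

End CliffordProduct.

HB.instance Definition _ (R : comNzRingType) n :=
  GRing.Zmodule_isNzRing.Build (clifford R n)
    cl_mulA cl_mul1l cl_mul1r cl_mulDl cl_mulDr cl_one_neq0.
HB.instance Definition _ (R : comNzRingType) n :=
  GRing.Lmodule_isLalgebra.Build R (clifford R n) cl_scaleAl.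
HB.instance Definition _ (R : comNzRingType) n :=
  GRing.Lalgebra_isAlgebra.Build R (clifford R n) cl_scaleAr.

Section CliffordTheory.
Context {R : comNzRingType} {n : nat}.
Implicit Types (S U W : {set 'I_n}) (a b : clifford R n) (X : 'rV[R]_n).

Lemma cl_basisM S U :
  cl_basis S * cl_basis U = cl_sign S U *: cl_basis (symdiff S U)
    :> clifford R n.
Proof.
apply/ffunP => W; rewrite [LHS]cl_mulE (bigD1 S) //= big1.
  rewrite addr0 ![cl_basis _ _]ffunE eqxx mul1r cl_scaleE.
  rewrite [cl_basis _ _]ffunE symdiff_eq.
  by case: eqP => [->|_]; rewrite ?symdiffK ?mulr0.
by move=> V /negPf VS; rewrite [cl_basis S V]ffunE VS mul0r mulr0.
Qed.

Lemma cl_basisE S :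
  cl_basis S = \prod_(i <- enum S) cl_basis (finset.set1 i) :> clifford R n.
Proof.
suff H (s : seq 'I_n) : sorted ltn [seq val i | i <- s] ->
    cl_basis [set i in s] = \prod_(i <- s) cl_basis (finset.set1 i)
      :> clifford R n.
  rewrite -H; first by congr cl_basis; apply/setP => i; rewrite inE mem_enum.
  rewrite sorted_map /enum_mem; apply: sorted_filter; first exact/relpre_trans/ltn_trans.
  by rewrite -enumT -sorted_map val_enum_ord iota_ltn_sorted.
elim: s => [_|i s IHs /= si].
  rewrite big_nil; congr cl_basis; apply/setP => i; by rewrite !inE.
rewrite big_cons -IHs ?(path_sorted si) // cl_basisM.
have lt_i j : j \in s -> (i < j)%N.
  move=> js; have /allP/(_ (val j)) := order_path_min ltn_trans si.
  by apply; apply: map_f.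
have -> : cl_sign (finset.set1 i) [set j in s] = 1 :> R.
  rewrite cl_signE big1 // => k _; rewrite big1 // => j _.
  rewrite !inE; case: eqP => [->|//] /=.
  by case: (boolP (j \in s)) => // /lt_i; rewrite ltnNge => /negPf ->.
rewrite scale1r symdiff1; last by rewrite inE; apply/negP => /lt_i; rewrite ltnn.
by congr cl_basis; apply/setP => j; rewrite !inE.
Qed.

Lemma cl_vecMl X a W :
  (cl_vec X * a) W =
  \sum_i X 0 i * (cl_sign (finset.set1 i) (symdiff (finset.set1 i) W) *
                  a (symdiff (finset.set1 i) W)).
Proof.
rewrite /cl_vec mulr_suml sum_ffunE; apply: eq_bigr => i _.
rewrite -scalerAl cl_scaleE; congr (_ * _).
rewrite [LHS]cl_mulE (bigD1 (finset.set1 i)) //= big1.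
  by rewrite addr0 [cl_basis _ _]ffunE eqxx mul1r.
by move=> V /negPf VS; rewrite [cl_basis _ V]ffunE VS mul0r mulr0.
Qed.

Lemma cl_vecMr X a W :
  (a * cl_vec X) W =
  \sum_i X 0 i * (cl_sign (symdiff (finset.set1 i) W) (finset.set1 i) *
                  a (symdiff (finset.set1 i) W)).
Proof.
rewrite /cl_vec mulr_sumr sum_ffunE; apply: eq_bigr => i _.
rewrite -scalerAr cl_scaleE; congr (_ * _).
rewrite [LHS]cl_mulE (bigD1 (symdiff (finset.set1 i) W)) //= big1.
  by rewrite addr0 -symdiffA symdiffv symdiffn0 [cl_basis _ _]ffunE eqxx mulr1.
move=> V VS; rewrite [cl_basis _ _]ffunE symdiff_eq.
have -> : (W == symdiff V (finset.set1 i)) = false; last by rewrite !mulr0.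
by rewrite symdiffC eq_sym symdiff_eq (negPf VS).
Qed.

Lemma cl_sign11 (i j : 'I_n) :
  cl_sign (finset.set1 i) (finset.set1 j) = (-1) ^+ (j <= i)%N :> R.
Proof.
rewrite cl_signE (bigD1 i) //= [X in _ * X]big1 ?mulr1.
  rewrite (bigD1 j) //= [X in _ * X]big1 ?mulr1 ?inE ?eqxx //.
  by move=> k /negPf kj; rewrite !inE kj andbF.
by move=> k /negPf ki; rewrite big1 // => l _; rewrite !inE ki.
Qed.

Lemma cl_vec_sqr X : cl_vec X * cl_vec X = - (\sum_i X 0 i ^+ 2)%:A.
Proof.
pose F (i j : 'I_n) : clifford R n :=
  (X 0 i * X 0 j) *: (cl_basis (finset.set1 i) * cl_basis (finset.set1 j)).
have FN (i j : 'I_n) : (j < i)%N -> F i j + F j i = 0.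
  move=> ji; rewrite /F !cl_basisM !cl_sign11 (ltnW ji) leqNgt ji.
  by rewrite (symdiffC (finset.set1 i)) (mulrC (X 0 i)) scaleN1r scale1r scalerN addNr.
have FD i : F i i = - (X 0 i ^+ 2)%:A.
  by rewrite /F cl_basisM cl_sign11 leqnn symdiffv scaleN1r scalerN expr2.
have -> : cl_vec X * cl_vec X = \sum_i \sum_j F i j.
  rewrite /cl_vec mulr_suml; apply: eq_bigr => i _; rewrite mulr_sumr.
  by apply: eq_bigr => j _; rewrite -scalerAl -scalerAr scalerA.
transitivity (\sum_i (F i i + \sum_(j : 'I_n | (j < i)%N) F i j
                            + \sum_(j : 'I_n | (i < j)%N) F i j)).
  apply: eq_bigr => i _; rewrite (bigD1 i) //= -addrA; congr (_ + _).
  rewrite (bigID (fun j : 'I_n => (j < i)%N)) /=.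
  by congr (_ + _); apply: eq_bigl => j; rewrite -val_eqE /=; case: ltngtP.
rewrite !big_split /= -addrA.
rewrite [X in _ + (_ + X)](exchange_big_dep xpredT) //= -big_split /=.
rewrite [X in _ + X]big1 ?addr0; last first.
  by move=> i _; rewrite -big_split big1 // => j /FN.
by under eq_bigr do rewrite FD; rewrite sumrN scaler_suml.
Qed.

Lemma cl_sign1l (i : 'I_n) S :
  cl_sign (finset.set1 i) S = (-1) ^+ #|[set j in S | (j <= i)%N]| :> R.
Proof.
rewrite cl_signE (bigD1 i) //= [X in _ * X]big1 ?mulr1; last first.
  by move=> k /negPf ki; rewrite big1 // => l _; rewrite !inE ki.
rewrite -prodr_const [RHS]big_mkcond; apply: eq_bigr => j _.
by rewrite !inE eqxx /=; case: ifP.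
Qed.

Lemma cl_sign1r (i : 'I_n) S :
  cl_sign S (finset.set1 i) = (-1) ^+ #|[set j in S | (i <= j)%N]| :> R.
Proof.
rewrite cl_signE exchange_big (bigD1 i) //= [X in _ * X]big1 ?mulr1; last first.
  by move=> k /negPf ki; rewrite big1 // => l _; rewrite !inE ki andbF.
rewrite -prodr_const [RHS]big_mkcond; apply: eq_bigr => j _.
by rewrite !inE eqxx /=; case: ifP.
Qed.

Lemma cl_sign1rl (i : 'I_n) S : cl_sign S (finset.set1 i) =
  (-1) ^+ (#|S| + (i \in S)) * cl_sign (finset.set1 i) S :> R.
Proof.
rewrite cl_sign1l cl_sign1r -exprD.
set L := [set j in S | (j <= i)%N]; set G := [set j in S | (i <= j)%N].
have <- : (#|L :|: G| + #|L :&: G| = #|S| + (i \in S))%N.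
  congr (_ + _)%N.
    congr #|pred_of_set _|; apply/setP => j; rewrite !inE.
    by rewrite -andb_orr leq_total andbT.
  have -> : (L :&: G = if i \in S then finset.set1 i else finset.set0)%SET.
    apply/setP => j; rewrite !inE; case: (eqVneq j i) => [->|ji].
      by rewrite leqnn !andbT andbb; case: ifP; rewrite !inE ?eqxx.
    have -> : (j \in S) && (j <= i)%N && ((j \in S) && (i <= j)%N) = false.
      by move: ji; rewrite -val_eqE /=; case: ltngtP; rewrite ?andbF.
    by case: ifP; rewrite !inE ?(negPf ji).
  by case: ifP; rewrite ?cards1 ?cards0.
rewrite cardsUI addnAC addnn -mul2n exprD exprM sqrrN expr1n.
by rewrite expr1n mul1r.
Qed.

Lemma contractE k X a : is_form k a ->
  contract X a *+ 2 = (-1) ^+ k *: (a * cl_vec X) - cl_vec X * a.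
Proof.
move=> ak; apply/ffunP => W; rewrite mulr2n [LHS]ffunE [RHS]ffunE.
rewrite [(- _ : clifford R n) W]ffunE cl_scaleE cl_vecMr cl_vecMl.
rewrite mulr_sumr -sumrB [contract _ _ _]ffunE big_mkcond -big_split /=.
apply: eq_bigr => i _; set S := symdiff _ W.
have [Sk|/ak aS] := eqVneq #|S| k; last first.
  rewrite aS !mulr0 subr0; case: ifP; rewrite ?addr0 // => iW.
  by move: aS; rewrite /S symdiff1 // => ->; rewrite !mulr0 addr0.
have iS : (i \in S) = (i \notin W) by rewrite !inE eqxx addTb.
rewrite cl_sign1rl Sk iS exprD.
have kk : (-1) ^+ k * (-1) ^+ k = 1 :> R by rewrite -expr2 sqrr_sign.
case: (boolP (i \in W)) => iW /=.
  rewrite expr0 mulr1 addr0 [X in X - _](_ : _ =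
    ((-1) ^+ k * (-1) ^+ k) * (X 0 i * (cl_sign (finset.set1 i) S * a S)));
    last by ring.
  by rewrite kk mul1r subrr.
rewrite -symdiff1 // -/S.
have -> : cl_sign (finset.set1 i) S =
          - (-1) ^+ #|[set j in W | (j < i)%N]| :> R.
  rewrite cl_sign1l /S symdiff1 // -[RHS]mulN1r -exprS; congr (_ ^+ _).
  rewrite (cardD1 i) !inE eqxx leqnn /=; congr _.+1.
  apply: eq_card => j; rewrite !inE ltn_neqAle -val_eqE.
  by case: eqVneq => [->|_] /=; rewrite ?(negPf iW) ?andbF.
set e := (-1) ^+ #|_|.
rewrite expr1 [X in X - _](_ : _ =
    ((-1) ^+ k * (-1) ^+ k) * (X 0 i * (e * a S))); last by ring.
by rewrite kk; ring.
Qed.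

End CliffordTheory.

Local Open Scope classical_set_scope.

Section LieSubalgebra.
Context {R : nzRingType} {A : algType R}.
Implicit Types (a b : A) (g I U V : set A).

Definition lie_bracket a b : A := a * b - b * a.

Definition lie_subalgebra g : Prop :=
  submod_closed [in g] /\ forall a b, g a -> g b -> g (lie_bracket a b).

Definition lie_generated (S : set A) : set A := smallest lie_subalgebra S.

(* [U, V]: the linear span of the brackets, not just the set of brackets. *)
Definition lie_product U V : set A :=
  smallest (fun W : set A => submod_closed [in W])
    [set lie_bracket a b | a in U & b in V].

Definition lie_ideal g I : Prop :=
  [/\ submod_closed [in I], I `<=` g & forall a b, g a -> I b -> I (lie_bracket a b)].

Definition lie_solvable I : Prop :=
  exists k : nat, iter k (fun J => lie_product J J) I = [set 0].

(* Vanishing radical, so that the zero Lie algebra is semisimple. *)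
Definition lie_semisimple g : Prop :=
  lie_subalgebra g /\ forall I, lie_ideal g I -> lie_solvable I -> I = [set 0].

Lemma lie_generated_subalgebra (S : set A) : lie_subalgebra (lie_generated S).
Proof.
split; first split.
- by apply/mem_set => V [[[/set_mem V0 _] _] _].
- move=> k a b /set_mem Sa /set_mem Sb; apply/mem_set => V VS.
  have [[[_ Vlin] _] _] := VS.
  by apply/set_mem/Vlin; apply/mem_set; [exact: Sa|exact: Sb].
- by move=> a b Sa Sb V VS; have [[_ Vb] _] := VS; apply: Vb; [exact: Sa|exact: Sb].
Qed.

End LieSubalgebra.

Definition gstar {R : realType} {n : nat} (T : clifford R n) :
    set (clifford R n) :=
  lie_generated [set contract X T | X in [set: 'rV[R]_n]].

Definition hstar {R : realType} {n : nat} (T : clifford R n) :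
    set (clifford R n) :=
  lie_product (gstar T) (gstar T).

(* Main.v *)
Require Import Defs.
From HB Require Import structures.
From mathcomp Require Import all_boot all_order all_algebra.
From mathcomp Require Import all_classical all_reals.
From mathcomp Require Import ring.

(** Write [<a, b>] for the Euclidean inner product on the Clifford algebra that
    makes the products [e_S] orthonormal.  Left and right multiplication by
    [e_S] are signed permutations of this basis, and for [|S| = 1] or [2] they
    square to [-1]; hence they are skew, and so is [ad f] for every 2-form [f]
    ([ad2_skew]).  As the skew derivations form a Lie algebra, [ad a] is skew
    for every [a] in [g = gstar T] ([gstar_skew]): the form is invariant under
    [g], as for any compact Lie algebra.

    Invariance reduces both claims to the vanishing of the centre of [g].  An
    abelian ideal [I] is central, since for [a] in [I] and [b] in [g]
      [ |[a, b]|^2 = - <b, [a, [a, b]]> = 0 ];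
    so a trivial centre excludes nonzero abelian, hence nonzero solvable, ideals.
    Likewise an element of [g] orthogonal to the derived algebra is central, so
    once the centre vanishes [g] equals its derived algebra, by orthogonal
    projection ([cl_dot_split]).

    Only the vanishing of the centre ([gstar_center]) uses that [T] is a 3-form.
    A central [a] is orthogonal to all brackets of [g], hence it suffices that
    it is orthogonal to the generators [X _| T] ([central_ortho]).  Let [A] be
    the skew map [ad a] on vectors and
      [ t(X, Y, Z) = <[X _| T, Y], Z> ],
    which is [2 T(X, Y, Z)], so alternating.  Since [a] commutes with each
    [X _| T], the map [A] commutes with [ad (X _| T)], whence
      [ t(X, Y, A Y) = - t(X, A Y, Y) = t(A Y, X, Y) = - t(A Y, Y, X)
        = t(Y, A Y, X) = <A [Y _| T, Y], X> = 0 ].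
    The Casimir identity [sum_i (ad e_i)^2 f = - 8 f] for 2-forms ([casimir2])
    expresses [8 <a, X _| T>] as the sum of the terms [t(X, e_i, A e_i)], which
    vanish. *)

Set Implicit Arguments.
Unset Strict Implicit.
Unset Printing Implicit Defensive.

Import Order.TTheory GRing.Theory Num.Theory.
Local Open Scope ring_scope.
Local Open Scope classical_set_scope.

(* The name also denotes the contraction of the extended reals. *)
Local Notation contract := Defs.contract.

(** * Lie algebras inside an associative algebra *)

Section Bracket.
Context {R : nzRingType} {A : algType R}.
Implicit Types (a b c : A) (g I W S : set A).

Lemma submodP W : submod_closed [in W] <->
  W 0 /\ forall k a b, W a -> W b -> W (k *: a + b).
Proof.
split=> [[/set_mem W0 Wl]|[W0 Wl]]; split=> //.
- by move=> k a b /mem_set Wa /mem_set Wb; apply/set_mem/Wl.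
- exact/mem_set.
- by move=> k a b /set_mem Wa /set_mem Wb; apply/mem_set/Wl.
Qed.

Lemma submodB W a b : submod_closed [in W] -> W a -> W b -> W (a - b).
Proof. by move=> /submodP[_ Wl] Wa Wb; rewrite addrC -scaleN1r; apply: Wl. Qed.

Lemma lie_bracketC a b : lie_bracket a b = - lie_bracket b a.
Proof. by rewrite /lie_bracket opprB. Qed.

Lemma lie_bracketDl k a b c :
  lie_bracket (k *: a + b) c = k *: lie_bracket a c + lie_bracket b c.
Proof.
by rewrite /lie_bracket mulrDl mulrDr -scalerAl -scalerAr scalerBr opprD addrACA.
Qed.

Lemma lie_bracketDr k a b c :
  lie_bracket c (k *: a + b) = k *: lie_bracket c a + lie_bracket c b.
Proof.
by rewrite /lie_bracket mulrDl mulrDr -scalerAl -scalerAr scalerBr opprD addrACA.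
Qed.

HB.instance Definition _ c := GRing.isLinear.Build R A A *:%R
  (lie_bracket c) (fun k a b => lie_bracketDr k a b c).

Lemma lie_bracket0r a : lie_bracket a 0 = 0.
Proof. by rewrite /lie_bracket mulr0 mul0r subrr. Qed.

Lemma lie_bracket0l a : lie_bracket 0 a = 0.
Proof. by rewrite /lie_bracket mulr0 mul0r subrr. Qed.

Lemma lie_bracket_jacobi a b c :
  lie_bracket a (lie_bracket b c) =
  lie_bracket (lie_bracket a b) c + lie_bracket b (lie_bracket a c).
Proof.
rewrite /lie_bracket !(mulrBl, mulrBr) !mulrA !opprB.
rewrite [RHS]addrACA !(addrA, subrK) addrAC.
by rewrite -addrA addrACA !addrA [in RHS]addrAC.
Qed.

Lemma ad_bracket a b c : lie_bracket (lie_bracket a b) c =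
  lie_bracket a (lie_bracket b c) - lie_bracket b (lie_bracket a c).
Proof. by rewrite lie_bracket_jacobi addrK. Qed.

(** The commutator of two maps that preserve [W] preserves [W]. *)
Lemma normalizer_subalgebra W : submod_closed [in W] ->
  lie_subalgebra [set f | forall a, W a -> W (lie_bracket f a)].
Proof.
move=> Wl; have /submodP[W0 Wlin] := Wl; split.
  apply/submodP; split=> [a _|k f g fW gW a Wa] /=; first by rewrite lie_bracket0l.
  by rewrite lie_bracketDl; apply: Wlin; [apply: fW|apply: gW].
move=> f g fW gW a Wa /=.
by rewrite ad_bracket; apply: submodB => //; [apply/fW/gW|apply/gW/fW].
Qed.

Lemma lie_generated_gen S : S `<=` lie_generated S.
Proof. by move=> a Sa W [_]; apply. Qed.

Lemma lie_product_submod g I : submod_closed [in lie_product g I].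
Proof.
apply/submodP; split=> [W [/submodP[]]//|k a b Ia Ib W [Wl WI]].
by have /submodP[_] := Wl; apply; [apply: Ia|apply: Ib].
Qed.

Lemma lie_product_bracket g I a b :
  g a -> I b -> lie_product g I (lie_bracket a b).
Proof. by move=> ga Ib W [_]; apply; exists a => //; exists b. Qed.

Lemma lie_product_min g I W : submod_closed [in W] ->
  (forall a b, g a -> I b -> W (lie_bracket a b)) -> lie_product g I `<=` W.
Proof.
by move=> Wl WI c; apply; split=> // _ [a ga [b Ib <-]]; apply: WI.
Qed.

Lemma lie_generated_min S W : lie_subalgebra W -> S `<=` W ->
  lie_generated S `<=` W.
Proof. by move=> WL SW c; apply. Qed.

(** By the Jacobi identity; this is what keeps the derived series of an ideal
    inside the ideals of [g]. *)
Lemma lie_product_ideal g I : lie_ideal g I -> lie_ideal g (lie_product I I).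
Proof.
move=> [Il Ig gI]; split; first exact: lie_product_submod.
  apply: (subset_trans _ Ig); apply: lie_product_min => // a b Ia Ib.
  by apply: gI => //; apply: Ig.
move=> a b ga; move: b; pose W := [set b | lie_product I I (lie_bracket a b)].
apply: (@lie_product_min I I W); rewrite /W.
  have /submodP[D0 Dl] := lie_product_submod I I.
  apply/submodP; split=> [|k b c Wb Wc] /=; first by rewrite lie_bracket0r.
  by rewrite lie_bracketDr; apply: Dl.
move=> b c Ib Ic /=; rewrite lie_bracket_jacobi -[X in X + _]scale1r.
have /submodP[_] := lie_product_submod I I; apply.
- by apply: lie_product_bracket => //; apply: gI.
- by apply: lie_product_bracket => //; apply: gI.
Qed.

(** The last nonzero term of the derived series of a solvable ideal would be a
    nonzero abelian ideal. *)
Lemma lie_semisimple_abelian g : lie_subalgebra g ->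
  (forall I, lie_ideal g I ->
     (forall a b, I a -> I b -> lie_bracket a b = 0) -> I = [set 0]) ->
  lie_semisimple g.
Proof.
move=> gL gab; split=> // I + [k]; elim: k I => [|k IHk] I gI // DI.
have D0 : lie_product I I = [set 0].
  by apply: IHk; [exact: lie_product_ideal | rewrite -iterSr].
apply: gab => // a b Ia Ib.
have : lie_product I I (lie_bracket a b) by exact: lie_product_bracket.
by rewrite D0.
Qed.

End Bracket.

(** * Subspaces of a finite-dimensional space *)

(** A subset closed under linear combinations is only a predicate; a detachable
    subspace of maximal dimension inside it exhausts it, because any further
    vector would enlarge that subspace.  This gives access to dimensions. *)
Lemma submod_vspace (F : fieldType) (V : vectType F) (W : set V) :
  submod_closed [in W] -> exists U : {vspace V}, forall x, x \in U <-> W x.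
Proof.
move=> [/set_mem W0 Wl].
pose P k := `[< exists2 U : {vspace V}, \dim U = k & forall x, x \in U -> W x >].
have P0 : exists k, P k.
  exists 0%N; apply/asboolP; exists 0%VS => [|x]; first exact: dimv0.
  by rewrite memv0 => /eqP ->.
have Pmax k : P k -> (k <= \dim {:V})%N.
  by move=> /asboolP[U <- _]; apply/dimvS/subvf.
have [k /asboolP[U dimU UW] kmax] := ex_maxnP P0 Pmax.
exists U => x; split=> [/UW //|Wx]; apply/negPn/negP => xU.
have : P (\dim (U + <[x]>)%VS).
  apply/asboolP; exists (U + <[x]>)%VS => // y /memv_addP[u /UW Wu].
  move=> [z /vlineP[c ->] ->]; rewrite addrC.
  by apply/set_mem/Wl; apply/mem_set.
move=> /kmax; rewrite -dimU => leU.
have /eqP UE : U == (U + <[x]>)%VS by rewrite eqEdim addvSl.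
by move: xU; rewrite UE memvE addvSr.
Qed.

(** * The inner product of the Clifford algebra and the adjoint action *)

Section Dot.
Context {R : comNzRingType} {n : nat}.
Implicit Types (a b c f T : clifford R n) (X Y : 'rV[R]_n).
Implicit Types (S U W : {set 'I_n}).

Definition cl_dot a b : R := \sum_S a S * b S.

Lemma cl_dotC a b : cl_dot a b = cl_dot b a.
Proof. by apply: eq_bigr => S _; rewrite mulrC. Qed.

Lemma cl_dotDl k a b c : cl_dot (k *: a + b) c = k * cl_dot a c + cl_dot b c.
Proof.
rewrite mulr_sumr -big_split; apply: eq_bigr => S _ /=.
by rewrite ffunE cl_scaleE mulrDl mulrA.
Qed.

Lemma cl_dotDr k a b c : cl_dot c (k *: a + b) = k * cl_dot c a + cl_dot c b.
Proof. by rewrite cl_dotC cl_dotDl !(cl_dotC c). Qed.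

HB.instance Definition _ c := GRing.isLinear.Build R (clifford R n) R *%R
  (cl_dot c) (fun k a b => cl_dotDr k a b c).

Lemma cl_dotZl k a c : cl_dot (k *: a) c = k * cl_dot a c.
Proof. by rewrite cl_dotC linearZ /= cl_dotC. Qed.

Lemma cl_dotBl a b c : cl_dot (a - b) c = cl_dot a c - cl_dot b c.
Proof. by rewrite cl_dotC linearB /= !(cl_dotC c). Qed.

Lemma cl_dot_suml (I : Type) (r : seq I) (P : pred I) (F : I -> clifford R n) c :
  cl_dot (\sum_(i <- r | P i) F i) c = \sum_(i <- r | P i) cl_dot (F i) c.
Proof. by rewrite cl_dotC linear_sum; apply: eq_bigr => i _; rewrite cl_dotC. Qed.

Lemma cl_expand a : a = \sum_S a S *: cl_basis S.
Proof.
apply/ffunP => W; rewrite sum_ffunE (bigD1 W) //= big1 => [|S SW].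
  by rewrite addr0 cl_scaleE ffunE eqxx mulr1.
by rewrite cl_scaleE ffunE eq_sym (negPf SW) mulr0.
Qed.

Lemma cl_sign_sqr S U : cl_sign S U * cl_sign S U = 1 :> R.
Proof. by rewrite -expr2 sqrr_sign. Qed.

Lemma cl_basisMl S a W :
  (cl_basis S * a) W = cl_sign S (symdiff S W) * a (symdiff S W).
Proof.
rewrite [LHS]cl_mulE (bigD1 S) //= big1 ?addr0 ?ffunE ?eqxx ?mul1r // => U US.
by rewrite ffunE (negPf US) mul0r mulr0.
Qed.

Lemma cl_basisMr S a W :
  (a * cl_basis S) W = cl_sign (symdiff S W) S * a (symdiff S W).
Proof.
rewrite [LHS]cl_mulE (bigD1 (symdiff S W)) //= big1 ?addr0.
  by rewrite -symdiffA symdiffv symdiffn0 ffunE eqxx mulr1.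
move=> U US; rewrite [X in _ * (_ * X)](_ : _ = 0) ?mulr0 //.
rewrite ffunE symdiffC symdiff_eq; case: eqP => // WE.
by rewrite WE symdiffC eqxx in US.
Qed.

(** Left multiplication by [e_S] is a signed permutation of an orthonormal
    basis, so its transpose is its inverse, and [e_S e_S] is the sign
    [cl_sign S S]. *)
Lemma cl_dot_basisMl S a b :
  cl_dot (cl_basis S * a) b = cl_sign S S * cl_dot a (cl_basis S * b).
Proof.
rewrite mulr_sumr [LHS](reindex_inj (inv_inj (symdiffK S))).
apply: eq_bigr => W _; rewrite !cl_basisMl symdiffK cl_signDr.
by rewrite -[LHS]mul1r -(cl_sign_sqr S S); ring.
Qed.

Lemma cl_dot_basisMr S a b :
  cl_dot (a * cl_basis S) b = cl_sign S S * cl_dot a (b * cl_basis S).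
Proof.
rewrite mulr_sumr [LHS](reindex_inj (inv_inj (symdiffK S))).
apply: eq_bigr => W _; rewrite !cl_basisMr symdiffK cl_signDl.
by rewrite -[LHS]mul1r -(cl_sign_sqr S S); ring.
Qed.

Lemma cl_sign_diag1 (i : 'I_n) : cl_sign [set i]%SET [set i]%SET = -1 :> R.
Proof. by rewrite cl_sign11 leqnn. Qed.

Lemma cl_sign_diag2 S : #|S| = 2%N -> cl_sign S S = -1 :> R.
Proof.
move=> /eqP/cards2P[i [j [ij ->]]].
have -> : [set i; j]%SET = symdiff [set i]%SET [set j]%SET.
  by rewrite symdiff1 // inE.
rewrite !cl_signDl !cl_signDr !cl_sign11 !leqnn.
by move: ij; rewrite -val_eqE /=; case: ltngtP => // _ _;
  rewrite ?expr0 ?expr1; ring.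
Qed.

Lemma cl_bracketE a b : lie_bracket a b = a * b - b * a :> clifford R n.
Proof. by []. Qed.

Lemma ad_basis_skew S a b : cl_sign S S = -1 :> R ->
  cl_dot (cl_basis S * a - a * cl_basis S) b =
  - cl_dot a (cl_basis S * b - b * cl_basis S).
Proof.
move=> SS; rewrite cl_dotBl linearB /=.
by rewrite cl_dot_basisMl cl_dot_basisMr SS !mulN1r opprB opprK addrC.
Qed.

(** The hypothesis says that [e_S e_S = -1] whenever [e_S] occurs in [f]. *)
Lemma ad_skew f a b : (forall S, f S != 0 -> cl_sign S S = -1 :> R) ->
  cl_dot (lie_bracket f a) b = - cl_dot a (lie_bracket f b).
Proof.
move=> fS; rewrite [f]cl_expand !cl_bracketE !mulr_suml !mulr_sumr -!sumrB.
rewrite cl_dot_suml linear_sum -sumrN; apply: eq_bigr => S _.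
rewrite -!scalerAl -!scalerAr -!(scalerBr (V := clifford R n)) linearZ /=.
rewrite cl_dotZl; have [->|/fS fSS] := eqVneq (f S) 0; first by rewrite !mul0r oppr0.
rewrite -[RHS]mulrN; congr (_ * _).
exact: ad_basis_skew.
Qed.

Lemma ad2_skew f a b : is_form 2 f ->
  cl_dot (lie_bracket f a) b = - cl_dot a (lie_bracket f b).
Proof.
move=> f2; apply: ad_skew => S fS; apply: cl_sign_diag2.
by apply/eqP/contraT => /f2 f0; rewrite f0 eqxx in fS.
Qed.

Lemma ad1_skew (i : 'I_n) a b :
  cl_dot (lie_bracket (cl_basis [set i]%SET) a) b =
  - cl_dot a (lie_bracket (cl_basis [set i]%SET) b).
Proof.
apply: ad_skew => S; rewrite ffunE.
have [->|] := eqVneq S [set i]%SET; rewrite ?eqxx // => _.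
exact: cl_sign_diag1.
Qed.

(** For [|S|] even, [e_i] commutes with [e_S] when [i] is outside [S] and
    anticommutes with it when [i] is in [S]. *)
Lemma ad_basis1 (i : 'I_n) S : ~~ odd #|S| ->
  lie_bracket (cl_basis [set i]%SET) (lie_bracket (cl_basis [set i]%SET) (cl_basis S))
  = - ((i \in S)%:R *+ 4) *: cl_basis S :> clifford R n.
Proof.
move=> Sev; set e := cl_basis _.
have Se : cl_basis S * e = (-1) ^+ (i \in S) *: (e * cl_basis S).
  rewrite !cl_basisM cl_sign1rl -signr_odd oddD (negPf Sev) oddb scalerA.
  by rewrite symdiffC.
have ee : e * e = -1 by rewrite cl_basisM cl_sign11 leqnn symdiffv scaleN1r.
case: (i \in S) Se => Se; rewrite !cl_bracketE Se.
  rewrite expr1 scaleN1r opprK mulrDr mulrDl -[e * _ * e]mulrA Se.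
  rewrite expr1 scaleN1r mulrN mulrA ee mulN1r.
  by rewrite !opprK scaleNr scaler_nat -!opprD -!mulr2n -mulrnA.
by rewrite /= expr0 scale1r subrr mulr0 mul0r subrr mul0rn oppr0 scale0r.
Qed.

(** Each [e_S] is an eigenvector of every [(ad e_i)^2], with eigenvalue [-4] for
    [i] in [S] and [0] otherwise; so the sum has the eigenvalue [-4 |S|]. *)
Lemma casimir2 f : is_form 2 f ->
  \sum_i lie_bracket (cl_basis [set i]%SET) (lie_bracket (cl_basis [set i]%SET) f)
  = - (f *+ 8).
Proof.
move=> f2.
pose e i : clifford R n := cl_basis [set i]%SET.
transitivity
  (\sum_S f S *: \sum_i lie_bracket (e i) (lie_bracket (e i) (cl_basis S))).
  rewrite [in LHS](cl_expand f); under [RHS]eq_bigr do rewrite scaler_sumr.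
  rewrite exchange_big; apply: eq_bigr => i _ /=.
  by rewrite !linear_sum; apply: eq_bigr => S _; rewrite !linearZ.
rewrite [in RHS](cl_expand f) -sumrMnl -sumrN; apply: eq_bigr => S _.
have [S2|/f2 ->] := eqVneq #|S| 2%N; last by rewrite !scale0r mul0rn oppr0.
rewrite (eq_bigr _ (fun i _ => ad_basis1 i _)) ?S2 //.
have cardS : \sum_i (i \in S)%:R = 2 :> R.
  rewrite -S2 -sum1_card natr_sum [RHS]big_mkcond; apply: eq_bigr => i _ /=.
  by case: (i \in S).
rewrite -scaler_suml sumrN sumrMnl cardS -mulrnA scaleNr scaler_nat.
by rewrite scalerN scalerMnr.
Qed.

Lemma contract_form k X a : is_form k.+1 a -> is_form k (contract X a).
Proof.
move=> ak S Sk; rewrite ffunE big1 // => i iS.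
by rewrite ak ?mulr0 // cardsU1 iS eqSS.
Qed.

Lemma form1_vec a : is_form 1 a -> a = cl_vec (\row_i a [set i]%SET).
Proof.
move=> a1; apply/ffunP => S; rewrite sum_ffunE.
have [/eqP/cards1P[i ->]|S1] := eqVneq #|S| 1%N.
  rewrite (bigD1 i) //= cl_scaleE ffunE eqxx mulr1 mxE big1 ?addr0 // => j ji.
  by rewrite cl_scaleE ffunE (inj_eq set1_inj) eq_sym (negPf ji) mulr0.
rewrite a1 // big1 // => i _; rewrite cl_scaleE ffunE.
by case: (eqVneq S [set i]%SET) S1 => [->|]; rewrite ?mulr0 // cards1.
Qed.

(** The bracket of a 2-form with a vector is twice a contraction. *)
Lemma ad2_vec f X : is_form 2 f -> exists Y, lie_bracket f (cl_vec X) = cl_vec Y.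
Proof.
move=> f2; exists (\row_i (contract X f *+ 2) [set i]%SET).
rewrite -form1_vec; last first.
  by move=> S /(contract_form X f2) fS; rewrite mulr2n ffunE fS addr0.
by rewrite (contractE X f2) expr2 mulN1r opprK scale1r.
Qed.

Lemma cl_vecD X Y : cl_vec (X + Y) = cl_vec X + cl_vec Y :> clifford R n.
Proof. by rewrite -big_split; apply: eq_bigr => i _; rewrite mxE scalerDl. Qed.

Lemma cl_vec1 (i : 'I_n) :
  cl_vec (delta_mx 0 i) = cl_basis [set i]%SET :> clifford R n.
Proof.
rewrite /cl_vec (bigD1 i) //= big1 ?addr0 => [|j ji];
  rewrite mxE eqxx ?eqxx ?scale1r //.
by rewrite (negPf ji) scale0r.
Qed.

Lemma contractD X Y a : contract (X + Y) a = contract X a + contract Y a.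
Proof.
apply/ffunP => S; rewrite !ffunE -big_split; apply: eq_bigr => i _ /=.
by rewrite mxE mulrDr mulrDl.
Qed.

(** Up to a factor, [X _| T] is [T X + X T], whose bracket with [X] is the
    bracket of [T] with the scalar [X^2].  In exterior terms this is
    [X _| (X _| T) = 0]. *)
Lemma contract_alt T X : GRing.lreg (2 : R) -> is_form 3 T ->
  lie_bracket (contract X T) (cl_vec X) = 0.
Proof.
move=> reg2 T3; set x := cl_vec X.
have : lie_bracket (contract X T) x *+ 2 = 0.
  rewrite cl_bracketE mulrnBl -mulrnAl -mulrnAr (contractE X T3) -/x.
  rewrite -signr_odd /= expr1 scaleN1r.
  rewrite mulrBl mulrBr mulNr mulrN opprB opprK !mulrA.
  rewrite [x * x * T + _]addrC addrA subrK -[T * x * x]mulrA.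
  rewrite (cl_vec_sqr X : x * x = _) mulrN mulNr opprK.
  by rewrite -scalerAl -scalerAr mul1r mulr1 subrr.
move=> c2; apply/ffunP => S; rewrite [RHS]ffunE; apply: reg2.
by move/ffunP: c2 => /(_ S); rewrite mulr2n !ffunE mulr0 mulr_natl mulr2n.
Qed.

Lemma contract_antisym T X Y : GRing.lreg (2 : R) -> is_form 3 T ->
  lie_bracket (contract X T) (cl_vec Y) = - lie_bracket (contract Y T) (cl_vec X).
Proof.
move=> reg2 T3; apply/eqP; rewrite -addr_eq0; apply/eqP.
have := contract_alt (X + Y) reg2 T3.
rewrite contractD cl_vecD linearD /=.
rewrite -[contract X T]scale1r !lie_bracketDl !scale1r.
by rewrite !contract_alt // add0r addr0 addrC.
Qed.

End Dot.

(** * Consequences of positivity *)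

Section Euclidean.
Context {R : realFieldType} {n : nat}.
Implicit Types (a b c f T : clifford R n) (X Y : 'rV[R]_n).
Implicit Types (W : set (clifford R n)).

Lemma cl_dot_eq0 a : cl_dot a a = 0 -> a = 0.
Proof.
move/eqP; rewrite psumr_eq0 => [/allP a0|S _]; last by rewrite -expr2 sqr_ge0.
apply/ffunP => S; rewrite [RHS]ffunE; apply/eqP.
by have := a0 S (mem_index_enum _); rewrite /= mulf_eq0 orbb.
Qed.

(** Orthogonal projection onto a subspace.  With [U] the subspace and [b_i] a
    basis of it, the kernel of [phi a = sum_i <a, b_i> b_i] is the orthogonal
    complement of [U]; the image of [phi] lies in [U], so by dimension [U] and
    this complement span the whole space. *)
Lemma cl_dot_split W a : submod_closed [in W] ->
  exists2 w, W w & forall u, W u -> cl_dot (a - w) u = 0.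
Proof.
move=> /submod_vspace[U UW].
pose phi b : clifford R n :=
  \sum_(i < \dim U) cl_dot b (vbasis U)`_i *: (vbasis U)`_i.
have phi_lin : linear phi.
  move=> k b c; rewrite scaler_sumr -big_split; apply: eq_bigr => i _ /=.
  by rewrite cl_dotDl scalerDl scalerA.
pose phiL : {linear clifford R n -> clifford R n} :=
  HB.pack phi (GRing.isLinear.Build _ _ _ _ phi phi_lin).
have ker_orth b : b \in lker (linfun phiL) -> forall u, u \in U -> cl_dot b u = 0.
  rewrite memv_ker lfunE /= => /eqP phib0 u uU.
  have /eqP : cl_dot b (phi b) = 0 by rewrite phib0 linear0.
  rewrite linear_sum psumr_eq0 => [/allP bi0|i _]; last first.
    by rewrite linearZ /= -expr2 sqr_ge0.
  rewrite (coord_vbasis uU) linear_sum big1 // => i _; rewrite linearZ /=.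
  have := bi0 i (mem_index_enum _).
  by rewrite /= linearZ /= mulf_eq0 orbb => /eqP ->; rewrite mulr0.
have img_sub : (limg (linfun phiL) <= U)%VS.
  apply/subvP => _ /memv_imgP[b _ ->]; rewrite lfunE; apply: memv_suml => i _.
  by apply/memvZ/vbasis_mem/mem_nth; rewrite size_tuple.
have cap0 : (U :&: lker (linfun phiL) = 0)%VS.
  apply/eqP; rewrite -subv0; apply/subvP => b; rewrite memv_cap memv0.
  by move=> /andP[bU bK]; apply/eqP/cl_dot_eq0/(ker_orth _ bK).
have full : (U + lker (linfun phiL) = fullv)%VS.
  apply/eqP; rewrite eqEdim subvf -(limg_ker_dim (linfun phiL) fullv).
  rewrite capfv (dimv_disjoint_sum cap0) addnC leq_add2r; exact: dimvS.
have /memv_addP[w wU [b bK aE]] : a \in (U + lker (linfun phiL))%VS.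
  by rewrite full memvf.
exists w; first exact/UW; move=> u /UW uU.
by rewrite aE addrAC subrr add0r; apply: ker_orth.
Qed.

Lemma lreg2 : GRing.lreg (2 : R).
Proof. by apply/lregP; rewrite pnatr_eq0. Qed.

(** The heart of the proof: the third hypothesis on [a] is centrality with
    respect to the generators, and the alternation of [T] turns it into
    orthogonality. *)
Lemma central_ortho T a X : is_form 3 T ->
  (forall b c, cl_dot (lie_bracket a b) c = - cl_dot b (lie_bracket a c)) ->
  (forall Y, exists Y', lie_bracket a (cl_vec Y) = cl_vec Y') ->
  (forall Y, lie_bracket a (contract Y T) = 0) ->
  cl_dot a (contract X T) = 0.
Proof.
move=> T3 a_skew a_vec aT; have T2 Y := contract_form Y T3.
have commT Y b : lie_bracket a (lie_bracket (contract Y T) b) =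
                 lie_bracket (contract Y T) (lie_bracket a b).
  by rewrite lie_bracket_jacobi aT lie_bracket0l add0r.
(* This is [t(X, Y, A Y) = 0], where [A Y] is the vector [Y']. *)
have key Y : cl_dot (lie_bracket (contract X T) (cl_vec Y))
                    (lie_bracket a (cl_vec Y)) = 0.
  have [Y' aY] := a_vec Y.
  apply/eqP; rewrite -oppr_eq0 -a_skew commT aY (contract_antisym _ _ lreg2 T3).
  rewrite cl_dotC linearN /= oppr_eq0 cl_dotC ad2_skew // oppr_eq0.
  (* Now [<X, [Y' _| T, Y]>] is left; exchanging [Y'] and [Y] lets [ad a] out. *)
  rewrite (contract_antisym _ _ lreg2 T3) -aY -commT (contract_alt _ lreg2 T3).
  by rewrite lie_bracket0r oppr0 linear0.
have : cl_dot a (- (contract X T *+ 8)) = 0.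
  rewrite -casimir2 // linear_sum big1 // => i _ /=.
  rewrite -[LHS]opprK -ad1_skew -cl_vec1 lie_bracketC.
  rewrite [lie_bracket (cl_vec _) (contract _ _)]lie_bracketC.
  rewrite linearN /= cl_dotC linearN /= cl_dotC opprK cl_dotC.
  by rewrite key oppr0.
by move/eqP; rewrite linearN linearMn oppr_eq0 mulrn_eq0 /= => /eqP.
Qed.

Lemma skew_subalgebra : lie_subalgebra
  [set f | forall a b, cl_dot (lie_bracket f a) b = - cl_dot a (lie_bracket f b)].
Proof.
split.
  apply/submodP; split=> [a b|k f g fs gs a b] /=.
    by rewrite !lie_bracket0l linear0 cl_dotC linear0 oppr0.
  by rewrite !lie_bracketDl cl_dotDl cl_dotDr fs gs mulrN opprD.
move=> f g fs gs a b /=.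
rewrite !ad_bracket (cl_dotBl (lie_bracket f (lie_bracket g a))) /= !(fs, gs).
rewrite (linearB (cl_dot a) (lie_bracket f (lie_bracket g b))) /=.
by rewrite !opprK opprB addrC.
Qed.

End Euclidean.

(** * The Lie algebra generated by the contractions of a 3-form *)

Section Main.
Context {R : realType} {n : nat}.
Implicit Types (a b T : clifford R n) (X : 'rV[R]_n).

Lemma gstar_gen T X : gstar T (contract X T).
Proof. by apply: lie_generated_gen; exists X. Qed.

Lemma gstar_skew T f a b : is_form 3 T -> gstar T f ->
  cl_dot (lie_bracket f a) b = - cl_dot a (lie_bracket f b).
Proof.
move=> T3 gf; move: f gf a b; apply: lie_generated_min; first exact: skew_subalgebra.
by move=> _ [X _ <-] a b; apply/ad2_skew/contract_form.
Qed.

Lemma gstar_vec T f X : is_form 3 T -> gstar T f ->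
  exists Y, lie_bracket f (cl_vec X) = cl_vec Y.
Proof.
move=> T3 gf; pose V := range (@cl_vec R n).
suff fV : forall a, V a -> V (lie_bracket f a).
  by have [|Y _ <-] := fV (cl_vec X); [exists X | exists Y].
move: f gf; apply: lie_generated_min.
  apply/normalizer_subalgebra/submodP; split.
    by exists 0 => //; rewrite /cl_vec big1 // => i _; rewrite mxE scale0r.
  move=> k _ _ [Y _ <-] [Z _ <-]; exists (k *: Y + Z) => //.
  rewrite cl_vecD /cl_vec scaler_sumr; congr (_ + _).
  by apply: eq_bigr => i _; rewrite mxE scalerA.
move=> _ [Y _ <-] _ [Z _ <-]; have [Y' ->] := ad2_vec Z (contract_form Y T3).
by exists Y'.
Qed.

(** The elements of [g] orthogonal to the central [a] form a subalgebra, by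
    invariance, and it contains the generators by [central_ortho]; so [a] is
    orthogonal to itself. *)
Lemma gstar_center T a : is_form 3 T -> gstar T a ->
  (forall b, gstar T b -> lie_bracket a b = 0) -> a = 0.
Proof.
move=> T3 ga az; apply: cl_dot_eq0.
have [gl gbr] : lie_subalgebra (gstar T) := lie_generated_subalgebra _.
suff /(_ a ga)[] : gstar T `<=` [set b | gstar T b /\ cl_dot a b = 0] by [].
apply: lie_generated_min; last first.
  move=> _ [X _ <-]; split; first exact: gstar_gen.
  apply: central_ortho => // [b c|Y|Y]; first exact: (gstar_skew _ _ T3).
    exact: (gstar_vec _ T3).
  by apply: az; apply: gstar_gen.
have [g0 glin] := (submodP _).1 gl.
split.
  apply/submodP; split; first by split; [exact: g0|rewrite linear0].
  move=> k b c [gb b0] [gc c0]; split; first exact: glin.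
  by rewrite cl_dotDr b0 c0 mulr0 addr0.
move=> b c [gb _] [gc _]; split; first exact: gbr.
apply/eqP; rewrite -oppr_eq0 -(gstar_skew _ _ T3 gb) lie_bracketC az // oppr0.
by rewrite cl_dotC linear0.
Qed.

End Main.

Theorem theorem4p1 (R : realType) (n : nat) (T : clifford R n)
  (hT : is_form 3 T) :
  lie_semisimple (gstar T) /\ hstar T = gstar T.
Proof.
have gL : lie_subalgebra (gstar T) by apply: lie_generated_subalgebra.
have [gl gbr] := gL.
split.
  apply: lie_semisimple_abelian => // I [Il Ig gI] Iab.
  have [I0 _] := (submodP I).1 Il.
  apply/seteqP; split=> [a Ia|_ -> //]; have ga := Ig a Ia.
  apply: (gstar_center hT) => // b gb; apply: cl_dot_eq0.
  have Iab1 : I (lie_bracket a b).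
    by rewrite lie_bracketC -sub0r; apply: submodB I0 (gI _ _ gb Ia).
  by rewrite (gstar_skew _ _ hT ga) (Iab _ _ Ia Iab1) linear0 oppr0.
have hg : hstar T `<=` gstar T by apply: lie_product_min.
have hl : submod_closed [in hstar T] by apply: lie_product_submod.
apply/seteqP; split=> // a ga.
(* [w] is the projection of [a]; the difference is orthogonal to the
   derived algebra. *)
have [w hw orth] := cl_dot_split a hl.
suff /eqP : a - w = 0 by rewrite subr_eq0 => /eqP ->.
have gaw : gstar T (a - w) by exact: submodB gl ga (hg _ hw).
apply: (gstar_center hT gaw) => b gb; rewrite lie_bracketC.
apply/eqP; rewrite oppr_eq0; apply/eqP/cl_dot_eq0.
rewrite (gstar_skew _ _ hT gb) orth ?oppr0 //.
by apply: lie_product_bracket => //; apply: gbr.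
Qed.
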